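(* Let $n\ge 1$ and $b\ge 2$ be integers, and let $w$ be a nonempty word over an $n$-letter alphabet. In the two-dimensional setting with $(b\times b)$-letter replacement rules, $$F_2^{d}(b,n,w)\le \mathcal{W}_2(b,n,|w|).$$ That is, for every choice of $(b\times b)$-letter replacement rules and every starting level $L_1$, if $w$ appears diagonally on some level, then it appears diagonally on some level $L_k$ with $k\le \mathcal{W}_2(b,n,|w|)$.
   Context: Fix an alphabet with $n$ letters. A word is a nonempty finite string of letters; $|w|$ is the length of $w$. Two-dimensional setting: a replacement rule assigns to each letter $a$ a $b\times b$ array $R(a)$ of letters. For a rectangular array (grid) $G$ of letters, $R(G)$ is the array obtained by replacing each letter of $G$ by its $b\times b$ block, keeping the blocks in the same relative positions. The first level $L_1$ is any nonempty rectangular grid of letters and $L_{k+1}=R(L_k)$ for $k\ge 1$. A word $w=w_1\cdots w_m$ appears diagonally on $L_k$ if there is a cell $(i,j)$ (row $i$ counted from the top, column $j$ counted from the left) such that for $t=0,\dots,m-1$ the cell $(i+t,j+t)$ of $L_k$ exists and contains $w_{t+1}$ (so diagonals are read from upper left to lower right). It appears diagonally for the first time on $L_k$ if $k$ is the least index such that it appears diagonally on $L_k$. $F_2^{d}(b,n,w)$ denotes the latest level on which $w$ can appear diagonally for the first time, i.e. the supremum, over all choices of replacement rules and all $L_1$ for which $w$ appears diagonally on at least one level, of the index of the level on which $w$ appears diagonally for the first time. The function $\mathcal{W}_2$ is defined by $$\mathcal{W}_2(b,n,|w|)=\begin{cases} n & |w|=1,\\ 2n^2+1 & |w|=2,\\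 \lceil \log_b(b|w|-b)\rceil+n^2+n^3 & |w|>2.\end{cases}$$ *)

(* Defs.v *)
From mathcomp Require Import all_boot all_order all_algebra.
From mathcomp Require Import classical_sets.

Set Implicit Arguments.
Unset Strict Implicit.
Unset Printing Implicit Defensive.

Record grid (A : Type) := Grid {
  nrows : nat;
  ncols : nat;
  cells : 'M[A]_(nrows, ncols) }.

Definition nonempty_grid (A : Type) (G : grid A) : bool :=
  (0 < nrows G) && (0 < ncols G).

Lemma mul_ord_gt0 (m b : nat) (i : 'I_(m * b)) : 0 < b.
Proof. by case: b i => // -[k]; rewrite muln0. Qed.

Lemma block_ord_subproof (m b : nat) (i : 'I_(m * b)) : i %/ b < m.
Proof. by rewrite ltn_divLR ?(mul_ord_gt0 i). Qed.

Lemma offset_ord_subproof (m b : nat) (i : 'I_(m * b)) : i %% b < b.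
Proof. by rewrite ltn_mod (mul_ord_gt0 i). Qed.

(* Index i of a line cut into m segments of length b is the offset
   [offset_ord i] inside the segment [block_ord i]. *)
Definition block_ord (m b : nat) (i : 'I_(m * b)) : 'I_m :=
  Ordinal (block_ord_subproof i).

Definition offset_ord (m b : nat) (i : 'I_(m * b)) : 'I_b :=
  Ordinal (offset_ord_subproof i).

Definition replace (A : Type) (b : nat) (R : A -> 'M[A]_b) (G : grid A) :
    grid A :=
  Grid (\matrix_(i < nrows G * b, j < ncols G * b)
          R (cells G (block_ord i) (block_ord j))
            (offset_ord i) (offset_ord j)).

(* Levels are numbered from 1; the index 0 is not a level. *)
Definition level (A : Type) (b : nat) (R : A -> 'M[A]_b) (L1 : grid A)
    (k : nat) : grid A :=
  iter k.-1 (replace R) L1.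

(* Rows are numbered from the top and columns from the left. *)
Definition appears_diag (A : Type) (w : seq A) (G : grid A) : Prop :=
  exists i j : nat, forall t : 'I_(size w),
    exists (i' : 'I_(nrows G)) (j' : 'I_(ncols G)),
      [/\ i' = i + t :> nat, j' = j + t :> nat &
          cells G i' j' = tnth (in_tuple w) t].

Definition first_appears_diag (A : Type) (b : nat) (R : A -> 'M[A]_b)
    (L1 : grid A) (w : seq A) (k : nat) : Prop :=
  [/\ 0 < k, appears_diag w (level R L1 k) &
      forall k', 0 < k' < k -> ~ appears_diag w (level R L1 k')].

Definition first_levels_diag (b n : nat) (w : seq 'I_n) : set nat :=
  [set k | exists (R : 'I_n -> 'M['I_n]_b) (L1 : grid 'I_n),
             nonempty_grid L1 /\ first_appears_diag R L1 w k].

(* F_2^d(b, n, w) = F.  The supremum is a relation rather than a function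
   because a set of natural numbers may be unbounded; the supremum in the
   extended sense is at most N exactly when [is_F2d b w F] for some F <= N. *)
Definition is_F2d (b n : nat) (w : seq 'I_n) (F : nat) : Prop :=
  supremums (first_levels_diag b w) F.

(* [up_log b m] is the least e with m <= b ^ e, i.e. the ceiling of log_b m when
   1 < b and 0 < m.  The last branch is meant for 2 < l, where the subtraction
   does not truncate; the value at l = 0 is irrelevant. *)
Definition W2 (b n l : nat) : nat :=
  match l with
  | 1 => n
  | 2 => 2 * n ^ 2 + 1
  | _ => up_log b (b * l - b) + n ^ 2 + n ^ 3
  end.

(* Main.v *)
Require Import Defs.
From mathcomp Require Import all_boot all_order all_algebra.
From mathcomp Require Import boolp classical_sets.
From mathcomp Require Import zify.

Set Implicit Arguments.
Unset Strict Implicit.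
Unset Printing Implicit Defensive.

(** Follow the diagonal segment that carries the first appearance of [w]
    backwards through the levels: [m] levels earlier, the cells from which it
    grows are obtained by dividing coordinates by [b ^ m].  As soon as
    [|w| - 1 <= b ^ m], these ancestors lie in a window of at most two rows and
    two columns, and a diagonal meets at most three of the four cells of such a
    window: the upper left one, the lower right one, and one of the other two,
    which stays the same one as long as the window keeps its four cells.

    The letters in the cells of the window that are used determine [w].  So if
    two levels have windows of the same shape with the same letters, the growth
    from the later one can be replayed from the earlier one and [w] appears
    sooner ([repeated_window]).  Hence the windows of a first appearance are
    pairwise distinct, and it remains to count them.  Going forward, a window
    never shrinks, so the levels split into three phases.
    - Single cell: at most [n] levels ([single_cell_phase]).
    - Two cells, side by side or one above the other (the same throughout): at
      most [n ^ 2] levels ([two_cell_phase]).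
    - Four cells: now every letter of the window arises from the letter at the
      same place one level before, through a fixed corner of its replacement
      block.  So the two or three letters that matter run along orbits of maps
      from the alphabet to itself.  The orbit of one letter has preperiod plus
      period at most [n]; for several letters preperiods combine by a maximum
      and periods by a least common multiple, where two periods are either
      equal or not both [n].  This gives at most [n ^ 3 - n + 1] levels
      ([four_cell_phase]), and [n ^ 2 - n + 1] when [|w| = 2], where the
      diagonal jumps from the upper left to the lower right cell
      ([four_cell_phase_pair]).

    The [- n] saved in the last phase pays for the first one.  For [|w| > 2],
    at most the ceiling of [log_b (|w| - 1)] levels come too late for the
    window to be that small; this is one less than the logarithm in [W2], and
    the difference absorbs the remaining [+ 1]. *)

(** * Eventually periodic sequences *)

Definition periodic_from (T : Type) (u : nat -> T) (s c : nat) : Prop :=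
  0 < c /\ forall m, s <= m -> u (m + c) = u m.

Lemma periodic_fromM (T : Type) (u : nat -> T) s c q m :
  periodic_from u s c -> s <= m -> u (m + q * c) = u m.
Proof.
move=> [_ uc] sm; elim: q => [|q IHq]; first by rewrite addn0.
by rewrite mulSn addnCA addnC uc ?IHq // (leq_trans sm) ?leq_addr.
Qed.

Lemma periodic_from_lcm (T1 T2 : Type) (u1 : nat -> T1) (u2 : nat -> T2)
    s1 c1 s2 c2 :
  periodic_from u1 s1 c1 -> periodic_from u2 s2 c2 ->
  periodic_from (fun m => (u1 m, u2 m)) (maxn s1 s2) (lcmn c1 c2).
Proof.
move=> P1 P2; split; first by rewrite lcmn_gt0 (proj1 P1) (proj1 P2).
move=> m; rewrite geq_max => /andP[s1m s2m].
have /dvdnP[q1 e1] := dvdn_lcml c1 c2.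
have /dvdnP[q2 e2] := dvdn_lcmr c1 c2.
by rewrite {1}e1 e2 (periodic_fromM _ P1) // (periodic_fromM _ P2).
Qed.

Lemma sequence_repeats (T : finType) (u : nat -> T) :
  exists s c, [/\ 0 < c, s + c <= #|T| & u (s + c) = u s].
Proof.
have [/injectiveP inj|/injectivePn[x [y xy uxy]]] :=
  boolP (injectiveb (fun x : 'I_#|T|.+1 => u x)).
  by have := leq_card _ inj; rewrite card_ord ltnn.
have {}xy : x != y :> nat by [].
have := ltn_ord x; have := ltn_ord y.
case: (ltngtP x y) xy => // lt_xy _ lty ltx.
  by exists x, (y - x); rewrite subn_gt0 (subnKC (ltnW lt_xy)).
by exists y, (x - y); rewrite subn_gt0 (subnKC (ltnW lt_xy)).
Qed.

Lemma orbit_periodic (T : finType) (f : T -> T) x :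
  exists s c, s + c <= #|T| /\ periodic_from (fun m => iter m f x) s c.
Proof.
have [s [c [c0 scT ec]]] := sequence_repeats (fun m => iter m f x).
exists s, c; split=> //; split=> // m sm.
have -> : m + c = m - s + (s + c) by lia.
by rewrite iterD ec -iterD subnK.
Qed.

(** The naive bound [n ^ 2] is improved because both periods can be close to
    [n] only when they are equal, and then their least common multiple is
    small: distinct [c2 < c1 <= n] give at most
    [n - c2 + c1 * c2 <= n + (n - 1) ^ 2]. *)
Lemma orbit2_periodic (T : finType) (f g : T -> T) x y :
  exists s c, s + c <= #|T| ^ 2 - #|T| + 1 /\
    periodic_from (fun m => (iter m f x, iter m g y)) s c.
Proof.
have [s1 [c1 [b1 P1]]] := orbit_periodic f x.
have [s2 [c2 [b2 P2]]] := orbit_periodic g y.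
exists (maxn s1 s2), (lcmn c1 c2); split; last exact: periodic_from_lcm.
have [c1_gt0 c2_gt0] := (proj1 P1, proj1 P2).
have [<-|c12] := eqVneq c1 c2; first by have /lcmn_idPl -> := dvdnn c1; nia.
have : lcmn c1 c2 <= c1 * c2.
  by rewrite -muln_lcm_gcd leq_pmulr ?gcdn_gt0 ?c1_gt0.
nia.
Qed.

(** Once two of the orbits are combined, the crude estimate by the product
    suffices: [(n ^ 2 - n + 1) * n <= n ^ 3 - n + 1]. *)
Lemma orbit3_periodic (T : finType) (f g h : T -> T) x y z :
  exists s c, s + c <= #|T| ^ 3 - #|T| + 1 /\
    periodic_from (fun m => (iter m f x, iter m g y, iter m h z)) s c.
Proof.
have [s1 [c1 [b1 P1]]] := orbit2_periodic f g x y.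
have [s2 [c2 [b2 P2]]] := orbit_periodic h z.
exists (maxn s1 s2), (lcmn c1 c2); split; last exact: periodic_from_lcm.
have [c1_gt0 c2_gt0] := (proj1 P1, proj1 P2).
have : lcmn c1 c2 <= c1 * c2.
  by rewrite -muln_lcm_gcd leq_pmulr ?gcdn_gt0 ?c1_gt0.
set n := #|T| in b1 b2 *; set N := n ^ 2 - n + 1 in b1.
have bnd : maxn s1 s2 + c1 * c2 <= N * n by nia.
have : N * n <= n ^ 3 - n + 1 by rewrite /N; nia.
lia.
Qed.

Lemma threshold (P : pred nat) N :
    (forall p q, p <= q -> q < N -> P p -> P q) ->
  exists m, [/\ m <= N, forall p, p < m -> ~~ P p
              & forall p, m <= p < N -> P p].
Proof.
move=> mono; pose Q p := P p || (p == N).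
have exQ : exists p, Q p by exists N; rewrite /Q eqxx orbT.
case: (ex_minnP exQ) => m Qm min_m; exists m; split.
- by apply: min_m; rewrite /Q eqxx orbT.
- move=> p pm; apply/negP => Pp.
  by have := min_m p; rewrite /Q Pp leqNgt pm => /(_ isT).
move=> p /andP[mp pN]; apply: (mono m p mp pN).
by case/orP: Qm => // /eqP mN; move: mp; rewrite mN leqNgt pN.
Qed.

(** * Growth of an unbounded plane of letters *)

(** What the two-cell and four-cell phases contribute for an alphabet of [n]
    letters.  Here [l] is the length of the word minus one, the distance
    between the first and the last cell of the segment. *)
Definition multi_cell_bound (l n : nat) : nat :=
  if l is 0 then 0 else if l is 1 then n ^ 2 + (n ^ 2 - n + 1)
  else n ^ 2 + (n ^ 3 - n + 1).

Section Plane.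

Variables (A : finType) (b : nat) (R : A -> nat -> nat -> A).
Variable V0 : nat -> nat -> A.
Hypothesis b_gt1 : 1 < b.

(** The level reached after [p] replacements, extended to all cells of the
    quadrant so that no bounds have to be carried along: the letter of a cell
    depends only on its own ancestors, so the cells outside the grid do not
    interfere with those inside. *)
Fixpoint plane (p i j : nat) : A :=
  if p is p'.+1 then R (plane p' (i %/ b) (j %/ b)) (i %% b) (j %% b)
  else V0 i j.

Lemma bX_gt0 m : 0 < b ^ m.
Proof. by rewrite expn_gt0 (ltnW b_gt1). Qed.

(** A cell is determined by the letter of its ancestor and by its place among
    the descendants of that ancestor. *)
Lemma plane_descend m p p' i j i' j' :
    i %% b ^ m = i' %% b ^ m -> j %% b ^ m = j' %% b ^ m ->
    plane p (i %/ b ^ m) (j %/ b ^ m) = plane p' (i' %/ b ^ m) (j' %/ b ^ m) ->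
  plane (p + m) i j = plane (p' + m) i' j'.
Proof.
elim: m i j i' j' => [|m IHm] i j i' j'.
  by rewrite !addn0 expn0 !divn1.
rewrite !addnS /= expnS => im jm E.
have lower x x' : x %% (b * b ^ m) = x' %% (b * b ^ m) ->
  x %% b = x' %% b /\ (x %/ b) %% b ^ m = (x' %/ b) %% b ^ m.
  move=> xm; split; last by rewrite !modn_divl mulnC xm.
  have bb : b %| b * b ^ m by apply: dvdn_mulr.
  by rewrite -(modn_dvdm x bb) xm (modn_dvdm x' bb).
have [-> im'] := lower _ _ im; have [-> jm'] := lower _ _ jm.
by rewrite (IHm _ _ (i' %/ b) (j' %/ b)) // -!divnMA.
Qed.

(** The cells [x] and [x + t] of a line have distinct ancestors [m] levels
    before. *)
Definition crosses (m x t : nat) : bool := x %/ b ^ m < (x + t) %/ b ^ m.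

Lemma crosses0 m x : crosses m x 0 = false.
Proof. by rewrite /crosses addn0 ltnn. Qed.

Lemma divn_crosses m x t :
  t <= b ^ m -> (x + t) %/ b ^ m = x %/ b ^ m + crosses m x t.
Proof.
move=> tb; rewrite /crosses.
have le1 : x %/ b ^ m <= (x + t) %/ b ^ m by rewrite leq_div2r ?leq_addr.
have le2 : (x + t) %/ b ^ m <= x %/ b ^ m + 1.
  by rewrite -(divnDMl 1) ?bX_gt0 // mul1n leq_div2r ?leq_add2l.
by case: ltnP => /=; lia.
Qed.

Lemma crosses_mono_t m x t t' :
  t <= t' -> crosses m x t -> crosses m x t'.
Proof. by move=> tt' /leq_trans; apply; rewrite leq_div2r ?leq_add2l. Qed.

Lemma crosses_anti_m m m' x t :
  m <= m' -> crosses m' x t -> crosses m x t.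
Proof.
move=> /subnKC <-; rewrite /crosses expnD !divnMA.
by rewrite !ltnNge; apply: contra => le; rewrite leq_div2r.
Qed.

(** If the segment from [x] to [x + t'] is split by a border between ancestors
    already [m'] levels before, then the border seen [m] levels before is the
    same one, so it separates the same cells. *)
Lemma crosses_const m m' x t t' :
    m <= m' -> t <= t' -> t' <= b ^ m -> crosses m' x t' ->
  crosses m x t = crosses m' x t.
Proof.
move=> mm' tt' t'b X'; apply/idP/idP; last exact: crosses_anti_m.
have X := crosses_anti_m mm' X' => Xt; move: X'.
rewrite /crosses -(subnKC mm') expnD !divnMA.
have tb := leq_trans tt' t'b.
by rewrite (divn_crosses x t'b) (divn_crosses x tb) Xt X.
Qed.

(** * The windows of ancestors of a diagonal segment *)

Section Occurrence.

(* The segment runs from (i, j) to (i + l, j + l) after k replacements. *)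
Variables (k i j l : nat).

Definition window (p x y : nat) : A :=
  plane p (i %/ b ^ (k - p) + x) (j %/ b ^ (k - p) + y).

(** The equations on the last cell say that the copies descend from the same
    cells of the starting plane, which makes both lie inside the level or both
    outside when the start is a finite grid. *)
Definition earlier_copy : Prop :=
  exists k' i' j', [/\ k' < k,
    (i' + l) %/ b ^ k' = (i + l) %/ b ^ k,
    (j' + l) %/ b ^ k' = (j + l) %/ b ^ k &
    forall t, t <= l -> plane k' (i' + t) (j' + t) = plane k (i + t) (j + t)].

(** The cells of the segment sit inside their ancestors at level [q] in the
    same way as their copies inside the corresponding cells at level [p], if
    the copy starts at the same residue modulo [b ^ (k - q)]. *)
Lemma repeated_window p q :
    p < q -> q <= k -> l <= b ^ (k - q) ->
    crosses (k - p) i l = crosses (k - q) i l ->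
    crosses (k - p) j l = crosses (k - q) j l ->
    (forall t, t <= l ->
      window p (crosses (k - q) i t) (crosses (k - q) j t)
      = window q (crosses (k - q) i t) (crosses (k - q) j t)) ->
  earlier_copy.
Proof.
move=> pq qk lb Xi Xj W; set m := k - q in lb Xi Xj W.
have pk : p <= k by lia.
have lb' : l <= b ^ (k - p).
  by rewrite (leq_trans lb) // leq_pexp2l ?(ltnW b_gt1) // /m; lia.
(* First coordinate of the copy: the ancestor is taken from level p, the place
   inside the ancestor from level q. *)
pose x' x := x %/ b ^ (k - p) * b ^ m + x %% b ^ m.
have modx' x t : (x' x + t) %% b ^ m = (x + t) %% b ^ m.
  by rewrite /x' -addnA modnMDl modnDml.
have divx' x t : t <= l ->
    (x' x + t) %/ b ^ m = x %/ b ^ (k - p) + crosses m x t.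
  move=> tl; rewrite /x' -addnA divnMDl ?bX_gt0 //; congr (_ + _).
  apply: (@addnI (x %/ b ^ m)); rewrite -divn_crosses ?(leq_trans tl) //.
  by rewrite -divnMDl ?bX_gt0 // addnA -divn_eq.
have top x : crosses (k - p) x l = crosses m x l ->
    (x' x + l) %/ b ^ (p + m) = (x + l) %/ b ^ k.
  move=> Xx; rewrite (addnC p m) expnD divnMA divx' // -Xx -divn_crosses //.
  by rewrite -divnMA -expnD subnK.
exists (p + m), (x' i), (x' j); split; [|exact: top|exact: top|].
  by rewrite /m; lia.
move=> t tl; rewrite -[in RHS](subnKC qk); apply: plane_descend => //.
rewrite !divx' // !divn_crosses; try exact: leq_trans lb.
exact: W.
Qed.

(** * The three phases *)

Section Phases.

(* From e levels before the end of the growth backwards, the ancestors of the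
   segment fit in two rows and two columns. *)
Variable e : nat.
Hypotheses (ek : e <= k) (le : l <= b ^ e) (nocopy : ~ earlier_copy).

Lemma l_le_bX q : q <= k - e -> l <= b ^ (k - q).
Proof.
by move=> qK; rewrite (leq_trans le) // leq_pexp2l ?(ltnW b_gt1) //; lia.
Qed.

Lemma single_cell_phase p0 : p0 <= (k - e).+1 ->
    (forall p, p < p0 ->
       ~~ crosses (k - p) i l /\ ~~ crosses (k - p) j l) ->
  p0 <= #|A|.
Proof.
move=> p0K S; rewrite leqNgt; apply/negP => big; apply: nocopy.
have [s [c [c0 sc E]]] := sequence_repeats (fun p => window p 0 0).
have [Xs Ys] := S s ltac:(lia); have [Xc Yc] := S (s + c) ltac:(lia).
apply: (@repeated_window s (s + c)); rewrite ?l_le_bX //; try lia.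
move=> t tl.
rewrite (negbTE (contra (crosses_mono_t tl) Xc)).
by rewrite (negbTE (contra (crosses_mono_t tl) Yc)) E.
Qed.

Lemma two_cell_phase (x y : bool) p0 p1 : p1 <= (k - e).+1 -> ~~ (x && y) ->
    (forall p, p0 <= p < p1 ->
       crosses (k - p) i l = x /\ crosses (k - p) j l = y) ->
  p1 <= p0 + #|A| ^ 2.
Proof.
move=> p1K xy M; rewrite leqNgt; apply/negP => big; apply: nocopy.
have [s [c [c0]]] :=
  sequence_repeats (fun t => (window (p0 + t) 0 0, window (p0 + t) x y)).
rewrite card_prod mulnn addnA => sc [E0 E1].
have [Xs Ys] := M (p0 + s) ltac:(lia).
have [Xc Yc] := M (p0 + s + c) ltac:(lia).
apply: (@repeated_window (p0 + s) (p0 + s + c)); rewrite ?l_le_bX //;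
  try by [lia | rewrite ?Xs ?Ys ?Xc ?Yc].
(* The cells of the segment meet no offsets other than (0, 0) and (x, y). *)
move=> t tl; have := @crosses_mono_t (k - (p0 + s + c)) i t l tl.
have := @crosses_mono_t (k - (p0 + s + c)) j t l tl; rewrite Xc Yc.
case: crosses => [/(_ isT) yT|_]; case: crosses => [/(_ isT) xT|_] //;
  by move: xy E1; rewrite ?xT ?yT //; case: (x); case: (y).
Qed.

(** Both coordinates of the segment cross a border already at level [p], so
    the window at level [p.+1] consists of the four cells around a corner where
    four blocks meet: the cell with offset [(x, y)] is a corner of the block of
    the cell with the same offset one level before. *)
Lemma window_step p (x y : bool) : p < k ->
    crosses (k - p) i l -> crosses (k - p) j l -> p.+1 <= k - e ->
  window p.+1 x y = R (window p x y) (if x then 0 else b.-1)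
                                      (if y then 0 else b.-1).
Proof.
move=> pk Xi Xj pK.
have lb := l_le_bX pK; have lb' := l_le_bX (ltnW pK).
have corner z (a : bool) : crosses (k - p) z l ->
    (z %/ b ^ (k - p.+1) + a) %/ b = z %/ b ^ (k - p) + a /\
    (z %/ b ^ (k - p.+1) + a) %% b = if a then 0 else b.-1.
  move=> Z; have ekp : k - p = (k - p.+1).+1 by lia.
  have Z' : crosses (k - p.+1) z l by apply: crosses_anti_m Z; lia.
  have := divn_crosses z lb'; rewrite Z.
  rewrite ekp expnSr !divnMA (divn_crosses z lb) Z' !addn1.
  set u := _ %/ b ^ _; rewrite divnS ?(ltnW b_gt1) //.
  (* A border between blocks can only lie just before a multiple of b. *)
  case bu: (b %| u.+1) => /= E; last by lia.
  case: a; rewrite ?addn1 ?addn0.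
    by rewrite divnS ?(ltnW b_gt1) // bu add1n (eqP bu).
  split=> //; have := @modn_pred u.+1 b; rewrite bu /=; apply=> //.
  by rewrite neq_ltn b_gt1 orbT.
rewrite /window /=; have [-> ->] := corner i x Xi.
by have [-> ->] := corner j y Xj.
Qed.

Lemma window_orbit p0 t (x y : bool) :
    crosses (k - p0) i l -> crosses (k - p0) j l -> p0 + t <= k - e ->
  window (p0 + t) x y =
  iter t (fun a => R a (if x then 0 else b.-1) (if y then 0 else b.-1))
    (window p0 x y).
Proof.
move=> Xi Xj; elim: t => [|t IHt]; first by rewrite addn0.
rewrite addnS => tK; rewrite window_step ?iterS ?IHt //; try lia.
  by apply: crosses_anti_m Xi; lia.
by apply: crosses_anti_m Xj; lia.
Qed.

(** In this phase the offsets used by the cells of the segment are the same on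
    all levels, so only those of the first level [p0] of the phase matter. *)
Lemma four_cell_repeat p0 s c :
    crosses (k - p0) i l -> crosses (k - p0) j l ->
    0 < c -> p0 + s + c <= k - e ->
    (forall t, t <= l ->
      let x := crosses (k - p0) i t in let y := crosses (k - p0) j t in
      window (p0 + (s + c)) x y = window (p0 + s) x y) ->
  False.
Proof.
move=> Xi Xj c0 scK W; apply: nocopy.
have const z p t : p0 <= p -> p <= k - e -> crosses (k - p0) z l -> t <= l ->
    crosses (k - p) z t = crosses (k - p0) z t.
  by move=> p0p pK Z tl; apply: crosses_const Z; rewrite ?l_le_bX //; lia.
apply: (@repeated_window (p0 + s) (p0 + (s + c))); rewrite ?l_le_bX //; try lia.
- by rewrite !const //; lia.
- by rewrite !const //; lia.
by move=> t tl; rewrite !const //; try lia; rewrite W.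
Qed.

(** Going down the diagonal, either the row border or the column border is
    crossed first, so besides the upper left and lower right cells only the
    cell with offset [(z, ~~ z)] is met, for one fixed [z]: three orbits. *)
Lemma four_cell_phase p0 : p0 <= k - e ->
    crosses (k - p0) i l -> crosses (k - p0) j l ->
  (k - e).+1 <= p0 + (#|A| ^ 3 - #|A| + 1).
Proof.
move=> p0K Xi Xj; rewrite leqNgt; apply/negP => big.
pose corner (x y : bool) a :=
  R a (if x then 0 else b.-1) (if y then 0 else b.-1).
have [z Hz] : exists z : bool, forall t, t <= l ->
    crosses (k - p0) i t != crosses (k - p0) j t ->
    crosses (k - p0) i t = z.
  have [[t0 [t0l X0 Y0]]|none] := pselect (exists t0,
      [/\ t0 <= l, crosses (k - p0) i t0 & ~~ crosses (k - p0) j t0]).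
    exists true => t tl; case Xt: crosses; case Yt: crosses => // _.
    case/orP: (leq_total t t0) => tt0.
      by rewrite (crosses_mono_t tt0 Yt) in Y0.
    by rewrite (crosses_mono_t tt0 X0) in Xt.
  exists false => t tl; case Xt: crosses; case Yt: crosses => // _.
  by case: none; exists t; rewrite Yt.
have [s [c [sc [c0 /(_ s (leqnn s)) [E0 E1 E2]]]]] :=
  orbit3_periodic (corner false false) (corner true true) (corner z (~~ z))
    (window p0 false false) (window p0 true true) (window p0 z (~~ z)).
apply: (@four_cell_repeat p0 s c) => //; first by lia.
move=> t tl /=; rewrite !window_orbit //; try lia.
have := Hz t tl; case: crosses; case: crosses => //.
  by move=> /(_ isT) zE; move: E2; rewrite -zE.
by move=> /(_ isT) zE; move: E2; rewrite -zE.
Qed.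

(** A segment of two cells meets only the upper left and lower right cells of
    the window: two orbits. *)
Lemma four_cell_phase_pair p0 : l <= 1 -> p0 <= k - e ->
    crosses (k - p0) i l -> crosses (k - p0) j l ->
  (k - e).+1 <= p0 + (#|A| ^ 2 - #|A| + 1).
Proof.
move=> l1 p0K Xi Xj; rewrite leqNgt; apply/negP => big.
pose corner (x y : bool) a :=
  R a (if x then 0 else b.-1) (if y then 0 else b.-1).
have [s [c [sc [c0 /(_ s (leqnn s)) [E0 E1]]]]] :=
  orbit2_periodic (corner false false) (corner true true)
    (window p0 false false) (window p0 true true).
apply: (@four_cell_repeat p0 s c) => //; first by lia.
move=> t tl /=; rewrite !window_orbit //; try lia.
have [->|tE] : t = 0 \/ t = l by lia.
  by rewrite /crosses !addn0 !ltnn.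
by rewrite tE Xi Xj.
Qed.

(** The phases are the levels before [p1], from [p1] to [p2], and from [p2] on,
    where [p1] is the first level on which some coordinate crosses a border and
    [p2] the first level on which both do. *)
Lemma level_bound : k.+1 <= e + #|A| + multi_cell_bound l #|A|.
Proof.
have mono z p q : p <= q -> crosses (k - p) z l -> crosses (k - q) z l.
  by move=> pq; apply: crosses_anti_m; lia.
have [|p1 [p1K below1 above1]] := @threshold
    (fun p => crosses (k - p) i l || crosses (k - p) j l) (k - e).+1.
  by move=> p q pq _ /orP[] /(mono _ _ _ pq) ->; rewrite ?orbT.
have [|p2 [p2K below2 above2]] := @threshold
    (fun p => crosses (k - p) i l && crosses (k - p) j l) (k - e).+1.
  by move=> p q pq _ /andP[/(mono _ _ _ pq) -> /(mono _ _ _ pq) ->].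
have B1 : p1 <= #|A|.
  apply: single_cell_phase => // p pp1.
  by have := below1 p pp1; rewrite negb_or => /andP[].
have [l0|l_gt0] := posnP l.
  have [p1E|] : p1 = (k - e).+1 \/ p1 <= k - e by lia.
    by rewrite l0; lia.
  by move=> p1e; have := above1 p1; rewrite l0 !crosses0 => /(_ ltac:(lia)).
(* Between p1 and p2 exactly one coordinate crosses a border, and it remains
   the same one since crossings persist. *)
have B2 : p2 <= p1 + #|A| ^ 2.
  have [|p12] := leqP p2 p1; first by lia.
  apply: (@two_cell_phase (crosses (k - p1) i l) (crosses (k - p1) j l)) => //.
    exact: below2.
  move=> p /andP[p1p pp2]; have := below2 p pp2; have := above1 p1 ltac:(lia).
  have := mono i _ _ p1p; have := mono j _ _ p1p.
  case: (crosses (k - p) i l); case: (crosses (k - p) j l);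
    case: (crosses (k - p1) i l); case: (crosses (k - p1) j l) => //= yp xp;
    by [have := xp isT | have := yp isT].
have [p2E|p2e] : p2 = (k - e).+1 \/ p2 <= k - e by lia.
  by rewrite /multi_cell_bound; case: (l) l_gt0 => [|[|?]] //; lia.
have /andP[Xi Xj] := above2 p2 ltac:(lia).
have := four_cell_phase p2e Xi Xj.
have := fun l1 => four_cell_phase_pair l1 p2e Xi Xj.
by rewrite /multi_cell_bound; case: (l) l_gt0 => [|[|?]] // _ H3 H2;
  [have {}H3 := H3 isT|]; lia.
Qed.

End Phases.
End Occurrence.
End Plane.

(** * Levels of a finite grid *)

Definition entry (A : Type) (a0 : A) m n (M : 'M[A]_(m, n)) (i j : nat) : A :=
  if insub i is Some i' then if insub j is Some j' then M i' j' else a0 else a0.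

Lemma entryE (A : Type) (a0 : A) m n (M : 'M[A]_(m, n)) (i : 'I_m) (j : 'I_n) :
  entry a0 M i j = M i j.
Proof. by rewrite /entry !valK. Qed.

Section Levels.

Variables (A : finType) (b : nat) (a0 : A).
Variables (R : A -> 'M[A]_b) (L : grid A).

Notation levels := (plane b (fun a => entry a (R a)) (entry a0 (cells L))).

Lemma nrows_iter p : nrows (iter p (replace R) L) = nrows L * b ^ p.
Proof. by elim: p => [|p IHp] /=; rewrite ?muln1 // IHp expnSr mulnA. Qed.

Lemma ncols_iter p : ncols (iter p (replace R) L) = ncols L * b ^ p.
Proof. by elim: p => [|p IHp] /=; rewrite ?muln1 // IHp expnSr mulnA. Qed.

(** The default letters never show here: a replacement rule is only read at
    offsets smaller than [b], and the start at cells of [L]. *)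
Lemma cells_iter p (i : 'I_(nrows (iter p (replace R) L)))
    (j : 'I_(ncols (iter p (replace R) L))) :
  cells (iter p (replace R) L) i j = levels p i j.
Proof.
elim: p i j => [|p IHp] i j /=; first by rewrite entryE.
by rewrite mxE IHp /= -(entryE (levels p (i %/ b) (j %/ b))).
Qed.

Lemma appears_diag_iter (w : seq A) p : 0 < size w ->
  appears_diag w (iter p (replace R) L) <->
  exists i j, [/\ i + (size w).-1 < nrows L * b ^ p,
                  j + (size w).-1 < ncols L * b ^ p
                & forall t, t < size w ->
                    levels p (i + t) (j + t) = nth a0 w t].
Proof.
move=> w_gt0; split=> [[i [j W]]|[i [j [ltr ltc W]]]]; exists i, j.
  split.
  - have [i' [_ [ei _ _]]] := W (Ordinal (ltac:(lia) : (size w).-1 < size w)).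
    by rewrite -nrows_iter -[i + _]ei.
  - have [_ [j' [_ ej _]]] := W (Ordinal (ltac:(lia) : (size w).-1 < size w)).
    by rewrite -ncols_iter -[j + _]ej.
  move=> t tw; have [i' [j' []]] := W (Ordinal tw).
  by rewrite cells_iter (tnth_nth a0) /= => -> ->.
move=> t; have tw := ltn_ord t.
have iP : i + t < nrows (iter p (replace R) L) by rewrite nrows_iter; lia.
have jP : j + t < ncols (iter p (replace R) L) by rewrite ncols_iter; lia.
exists (Ordinal iP), (Ordinal jP); split=> //.
by rewrite cells_iter /= W // (tnth_nth a0).
Qed.

End Levels.

(** * The bound on the first appearance *)

Lemma level_bound_le_W2 b n l : 1 < b -> 0 < l ->
  up_log b l.-1 + n + multi_cell_bound l.-1 n
  <= W2 b n l.
Proof.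
move=> b1; case: l => [//|[|[|l]]] _ /=.
- by rewrite up_log0 /multi_cell_bound; lia.
- by rewrite up_log1 /multi_cell_bound; nia.
rewrite (mulnS b l.+2) addKn up_logMp //.
have : n <= n ^ 3 by case: n => // n; rewrite -{1}[n.+1]expn1 leq_pexp2l.
by rewrite /multi_cell_bound; lia.
Qed.

Lemma first_level_bound (A : finType) b (R : A -> 'M[A]_b) (L : grid A)
    (w : seq A) k :
  1 < b -> 0 < size w -> first_appears_diag R L w k ->
  k <= W2 b #|A| (size w).
Proof.
move=> b1 w_gt0 [k0 Wk first]; have a0 : A by case: (w) w_gt0.
move: Wk; rewrite /level => /(appears_diag_iter a0 _ _ _ w_gt0).
case=> i [j [ltr ltc W]].
apply: leq_trans (level_bound_le_W2 #|A| b1 w_gt0); set e := up_log b _.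
have [|ek] := ltnP k.-1 e; first by lia.
rewrite -(prednK k0).
apply: (@level_bound A b (fun a => entry a (R a)) (entry a0 (cells L)) b1
          k.-1 i j (size w).-1 e ek).
  exact: up_logP.
case=> k' [i' [j' [k'k ri cj W']]].
(* Levels are counted from 1, replacements from 0. *)
apply: (first k'.+1); first by lia.
apply/(appears_diag_iter a0 _ _ _ w_gt0); exists i', j'; split.
- by rewrite -ltn_divLR ?bX_gt0 // ri ltn_divLR ?bX_gt0.
- by rewrite -ltn_divLR ?bX_gt0 // cj ltn_divLR ?bX_gt0.
by move=> t tw; rewrite W' ?W //; lia.
Qed.

Lemma bounded_supremum (X : set nat) N : (forall k, X k -> k <= N) ->
  exists F, supremums X F /\ F <= N.
Proof.
move=> XN; have exU : exists m, `[< ubound X m >] by exists N; apply/asboolP.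
case: (ex_minnP exU) => F /asboolP UF minF; exists F; split.
  by split=> // m Um; apply: minF; apply/asboolP.
by apply: minF; apply/asboolP.
Qed.

Theorem theorem12 (n b : nat) (hn : 1 <= n) (hb : 2 <= b)
    (w : seq 'I_n) (hw : 0 < size w) :
  (exists F : nat, is_F2d b w F /\ F <= W2 b n (size w)) /\
  (forall (R : 'I_n -> 'M['I_n]_b) (L1 : grid 'I_n),
      nonempty_grid L1 ->
      (exists k, 0 < k /\ appears_diag w (level R L1 k)) ->
      exists k, 0 < k <= W2 b n (size w) /\ appears_diag w (level R L1 k)).
Proof.
have bnd (R : 'I_n -> 'M['I_n]_b) L1 k :
    first_appears_diag R L1 w k -> k <= W2 b n (size w).
  by move=> /(first_level_bound hb hw); rewrite card_ord.
split; first by apply: bounded_supremum => k [R [L1 [_ /bnd]]].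
move=> R L1 _ [k0 Wk0].
have exk : exists k, `[< 0 < k /\ appears_diag w (level R L1 k) >].
  by exists k0; apply/asboolP.
case: (ex_minnP exk) => k /asboolP[k_gt0 Wk] mink; exists k.
rewrite k_gt0; split=> //; apply: (bnd R L1); split=> // k' /andP[k'0 k'k] Wk'.
by have := mink k' (asboolT (conj k'0 Wk')); rewrite leqNgt k'k.
Qed.
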